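(* Let $P$ be a (full) reachability Gramian and $Q$ a (full) observability Gramian of the system $$dx(t)=[f(x(t))+Bu(t)+G(x(t))u(t)]\,dt+[\Gamma(x(t))+M(u(t))]\,dw(t),\qquad y(t)=h(x(t))+Eu(t),$$ and let $\mathcal S\in\mathbb R^{n\times n}$ be an invertible balancing transformation, i.e. $$\mathcal SP\mathcal S^\top=\mathcal S^{-\top}Q\mathcal S^{-1}=\Sigma=\operatorname{diag}(\sigma_1,\dots,\sigma_n),\qquad\sigma_i>0 .$$ Let $1\le r<n$. Then the diagonal matrix $\Sigma_1=\operatorname{diag}(\sigma_1,\dots,\sigma_r)$ is both a (full) reachability Gramian (with the same matrix $\mathcal U$) and a (full) observability Gramian of the $r$-dimensional reduced system $$dx_r(t)=[f_r(x_r(t))+B_ru(t)+G_r(x_r(t))u(t)]\,dt+[\Gamma_r(x_r(t))+M_r(u(t))]\,dw(t),\qquad y_r(t)=h_r(x_r(t))+Eu(t).$$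
   Context: Setting: $w$ is an $\mathbb R^q$-valued Wiener process with $\mathbb E[w(t)w(t)^\top]=Kt$, $K=(k_{ij})_{i,j=1,\dots,q}$. $G(x)=[g_1(x)\ \cdots\ g_m(x)]$, $\Gamma(x)=[\gamma_1(x)\ \cdots\ \gamma_q(x)]$, where $f,g_i,\gamma_j:\mathbb R^n\to\mathbb R^n$ and $h:\mathbb R^n\to\mathbb R^p$ vanish at $0$ and are regular enough for unique global solutions to exist. $B,M_1,\dots,M_q\in\mathbb R^{n\times m}$, $M(z)=[M_1z\ \cdots\ M_qz]$ for $z\in\mathbb R^m$, $E\in\mathbb R^{p\times m}$; $u$ is an $\mathbb R^m$-valued adapted square-integrable control. $\langle\cdot,\cdot\rangle$ is the Euclidean inner product, $\|\cdot\|_F$ the Frobenius norm. Positive (semi)definite matrices are symmetric. Gramians: for positive semidefinite $X\in\mathbb R^{n\times n}$, $\delta>0$, put $V_X(x)=x^\top Xx$ and $$LV_X(x,y;\delta)=2\langle x-y,X(f(x)-f(y))\rangle+\delta^2\|X^{1/2}(G(x)-G(y))\|_F^2+\|X^{1/2}(\Gamma(x)-\Gamma(y))K^{1/2}\|_F^2 .$$ For a positive definite matrix $\mathcal U\in\mathbb R^{m\times m}$ (free parameter) set $$U_X=\mathcal U-\sum_{i,j=1}^qM_i^\top XM_jk_{ij},\qquad S_X(x,y)=B^\top X(x-y)+\sum_{i,j=1}^qM_i^\top X(\gamma_j(x)-\gamma_j(y))k_{ij}.$$ A positive definite $P\in\mathbb R^{n\times n}$ is a (full) reachability Gramian if $U_{P^{-1}}$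 is positive definite and, for some $\delta>0$, $LV_{P^{-1}}(x,y;\delta)\le-S_{P^{-1}}(x,y)^\top U_{P^{-1}}^{-1}S_{P^{-1}}(x,y)$ for all $x,y\in\mathbb R^n$. A positive (semi)definite $Q\in\mathbb R^{n\times n}$ is a (full) observability Gramian if, for some $\delta>0$, $LV_Q(x,y;\delta)\le-(h(x)-h(y))^\top(h(x)-h(y))$ for all $x,y\in\mathbb R^n$. For the reduced system (state dimension $r$) the definitions are the same with $n$ replaced by $r$ and $(f,B,G,\Gamma,M,h)$ replaced by $(f_r,B_r,G_r,\Gamma_r,M_r,h_r)$. Reduced coefficients: set $\tilde f=\mathcal Sf(\mathcal S^{-1}\cdot)$, $\tilde B=\mathcal SB$, $\tilde G=\mathcal SG(\mathcal S^{-1}\cdot)$, $\tilde\Gamma=\mathcal S\Gamma(\mathcal S^{-1}\cdot)$, $\tilde M(\cdot)=\mathcal SM(\cdot)$, $\tilde h=h(\mathcal S^{-1}\cdot)$. For $x_r\in\mathbb R^r$ let $\hat x_r=(x_r^\top,0)^\top\in\mathbb R^n$. Then $f_r(x_r),G_r(x_r),\Gamma_r(x_r)$ are the first $r$ rows of $\tilde f(\hat x_r),\tilde G(\hat x_r),\tilde\Gamma(\hat x_r)$; $B_r$, $M_r(z)$ are the first $r$ rows of $\tilde B$, $\tilde M(z)$; and $h_r(x_r)=\tilde h(\hat x_r)$. *)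

(* Defs.v *)
From HB Require Import structures.
From mathcomp Require Import all_boot all_order all_algebra.
From mathcomp Require Import boolp classical_sets reals.

Set Implicit Arguments.
Unset Strict Implicit.
Unset Printing Implicit Defensive.

Import Order.TTheory GRing.Theory Num.Theory.
Local Open Scope ring_scope.

Section LinearAlgebra.
Variable R : realType.

Definition inner n (u v : 'cV[R]_n) : R := \sum_(i < n) u i 0 * v i 0.

Definition frobenius m n (A : 'M[R]_(m, n)) : R :=
  Num.sqrt (\sum_(i < m) \sum_(j < n) A i j ^+ 2).

Definition posdef n (X : 'M[R]_n) : Prop :=
  X^T = X /\ forall v : 'cV[R]_n, v != 0 -> 0 < inner v (X *m v).

Definition possemidef n (X : 'M[R]_n) : Prop :=
  X^T = X /\ forall v : 'cV[R]_n, 0 <= inner v (X *m v).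

(* X^{1/2}, the unique positive semidefinite square root of a positive
   semidefinite X; the value 0 is only taken when X is not semidefinite. *)
Definition sqrtmx n (X : 'M[R]_n) : 'M[R]_n :=
  xget 0 [set Y : 'M[R]_n | possemidef Y /\ Y *m Y = X].

Section Truncation.
Variables (r n : nat) (le_rn : (r <= n)%N).

Definition first_rows k (A : 'M[R]_(n, k)) : 'M[R]_(r, k) :=
  rowsub (widen_ord le_rn) A.

Lemma first_rows0 k : first_rows (0 : 'M[R]_(n, k)) = 0.
Proof. by apply/matrixP => i j; rewrite !mxE. Qed.

End Truncation.

(* x_r |-> (x_r^T, 0)^T *)
Definition zero_pad r n (x : 'cV[R]_r) : 'cV[R]_n :=
  \col_(i < n) oapp (fun j : 'I_r => x j 0) 0 (insub (i : nat)).

Lemma zero_pad0 r n : zero_pad n (0 : 'cV[R]_r) = 0.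
Proof.
by apply/matrixP => i j; rewrite !mxE; case: insub => [k|] //=; rewrite mxE.
Qed.

End LinearAlgebra.

(* Coefficients of
     dx = [f(x) + B u + G(x) u] dt + [Gamma(x) + M(u)] dw,  y = h(x) + E u
   with n states, m inputs, q noises and p outputs. The columns of G(x) and
   Gamma(x) are the g_i(x) and gamma_j(x); the linear map M is given by the
   matrices M_1, .., M_q. *)
Record stoch_system (R : realType) (n m q p : nat) := StochSystem {
  sys_f : 'cV[R]_n -> 'cV[R]_n;
  sys_B : 'M[R]_(n, m);
  sys_G : 'cV[R]_n -> 'M[R]_(n, m);
  sys_Gamma : 'cV[R]_n -> 'M[R]_(n, q);
  sys_M : 'I_q -> 'M[R]_(n, m);
  sys_h : 'cV[R]_n -> 'cV[R]_p;
  sys_E : 'M[R]_(p, m);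
  sys_f0 : sys_f 0 = 0;
  sys_G0 : sys_G 0 = 0;
  sys_Gamma0 : sys_Gamma 0 = 0;
  sys_h0 : sys_h 0 = 0
}.

Section Systems.
Variable R : realType.

Definition sys_gamma n m q p (sys : stoch_system R n m q p) (j : 'I_q)
    (x : 'cV[R]_n) : 'cV[R]_n :=
  col j (sys_Gamma sys x).

(* M(z) = [M_1 z .. M_q z] *)
Definition sys_Mfun n m q p (sys : stoch_system R n m q p) (z : 'cV[R]_m) :
    'M[R]_(n, q) :=
  \matrix_(i < n, j < q) (sys_M sys j *m z) i 0.

Section Transform.
Variables (n m q p : nat) (S : 'M[R]_n) (sys : stoch_system R n m q p).

Let f x := S *m sys_f sys (invmx S *m x).
Let G x := S *m sys_G sys (invmx S *m x).
Let Gamma x := S *m sys_Gamma sys (invmx S *m x).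
Let h x := sys_h sys (invmx S *m x).

Fact transform_f0 : f 0 = 0.
Proof. by rewrite /f mulmx0 sys_f0 mulmx0. Qed.
Fact transform_G0 : G 0 = 0.
Proof. by rewrite /G mulmx0 sys_G0 mulmx0. Qed.
Fact transform_Gamma0 : Gamma 0 = 0.
Proof. by rewrite /Gamma mulmx0 sys_Gamma0 mulmx0. Qed.
Fact transform_h0 : h 0 = 0.
Proof. by rewrite /h mulmx0 sys_h0. Qed.

Definition transform : stoch_system R n m q p :=
  @StochSystem R n m q p f (S *m sys_B sys) G Gamma
    (fun j => S *m sys_M sys j) h (sys_E sys)
    transform_f0 transform_G0 transform_Gamma0 transform_h0.

Lemma transform_Mfun z : sys_Mfun transform z = S *m sys_Mfun sys z.
Proof.
apply/matrixP => i j; rewrite [LHS]mxE /= -mulmxA !mxE.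
by apply: eq_bigr => k _; rewrite [in RHS]mxE.
Qed.

End Transform.

Section Truncate.
Variables (r n m q p : nat) (le_rn : (r <= n)%N).
Variable sys : stoch_system R n m q p.

Let f (x : 'cV[R]_r) := first_rows le_rn (sys_f sys (zero_pad n x)).
Let G (x : 'cV[R]_r) := first_rows le_rn (sys_G sys (zero_pad n x)).
Let Gamma (x : 'cV[R]_r) := first_rows le_rn (sys_Gamma sys (zero_pad n x)).
Let h (x : 'cV[R]_r) := sys_h sys (zero_pad n x).

Fact truncate_f0 : f 0 = 0.
Proof. by rewrite /f zero_pad0 sys_f0 first_rows0. Qed.
Fact truncate_G0 : G 0 = 0.
Proof. by rewrite /G zero_pad0 sys_G0 first_rows0. Qed.
Fact truncate_Gamma0 : Gamma 0 = 0.
Proof. by rewrite /Gamma zero_pad0 sys_Gamma0 first_rows0. Qed.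
Fact truncate_h0 : h 0 = 0.
Proof. by rewrite /h zero_pad0 sys_h0. Qed.

Definition truncate : stoch_system R r m q p :=
  @StochSystem R r m q p f (first_rows le_rn (sys_B sys)) G Gamma
    (fun j => first_rows le_rn (sys_M sys j)) h (sys_E sys)
    truncate_f0 truncate_G0 truncate_Gamma0 truncate_h0.

Lemma truncate_Mfun z :
  sys_Mfun truncate z = first_rows le_rn (sys_Mfun sys z).
Proof.
apply/matrixP => i j; rewrite !mxE /=.
by apply: eq_bigr => k _; rewrite mxE.
Qed.

End Truncate.

Definition reduced_system r n m q p (le_rn : (r <= n)%N) (S : 'M[R]_n)
    (sys : stoch_system R n m q p) : stoch_system R r m q p :=
  truncate le_rn (transform S sys).

Section Gramians.
Variables (n m q p : nat) (K : 'M[R]_q) (sys : stoch_system R n m q p).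
Implicit Types (X : 'M[R]_n) (x y : 'cV[R]_n).

Let f := sys_f sys.
Let B := sys_B sys.
Let G := sys_G sys.
Let Gamma := sys_Gamma sys.
Let gamma := sys_gamma sys.
Let M := sys_M sys.
Let h := sys_h sys.

Definition LV X x y (delta : R) : R :=
  2 * inner (x - y) (X *m (f x - f y))
  + delta ^+ 2 * frobenius (sqrtmx X *m (G x - G y)) ^+ 2
  + frobenius (sqrtmx X *m (Gamma x - Gamma y) *m sqrtmx K) ^+ 2.

Definition Umx (U : 'M[R]_m) X : 'M[R]_m :=
  U - \sum_(i < q) \sum_(j < q) K i j *: ((M i)^T *m X *m M j).

Definition Svec X x y : 'cV[R]_m :=
  B^T *m X *m (x - y)
  + \sum_(i < q) \sum_(j < q)
      K i j *: ((M i)^T *m X *m (gamma j x - gamma j y)).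

Definition reachability_gramian (U : 'M[R]_m) (P : 'M[R]_n) : Prop :=
  [/\ posdef P,
      posdef (Umx U (invmx P)) &
      exists2 delta : R, 0 < delta &
        forall x y,
          LV (invmx P) x y delta
          <= - inner (Svec (invmx P) x y)
                     (invmx (Umx U (invmx P)) *m Svec (invmx P) x y)].

(* Positive definite Q are included, being positive semidefinite. *)
Definition observability_gramian (Q : 'M[R]_n) : Prop :=
  possemidef Q /\
  exists2 delta : R, 0 < delta &
    forall x y, LV Q x y delta <= - inner (h x - h y) (h x - h y).

End Gramians.
End Systems.

(* Main.v *)
Require Import Defs.
From mathcomp Require Import all_boot all_order all_algebra.
From mathcomp Require Import ring lra complex boolp classical_sets reals.

(** Both Gramian conditions are upper bounds on a dissipation functional, and
that functional can only decrease when the system is projected along a decoupled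
complement.

For a weight X, put
<<
  D_X(x, y, z) = 2 <x - y, X (f x - f y + B z)>
               + delta^2 ||X^(1/2) (G x - G y)||^2
               + ||X^(1/2) (Gamma x - Gamma y + M(z)) K^(1/2)||^2 - z^T U z.
>>
Expanding the noise term gives D_X = LV_X + 2 <z, S_X> - <z, U_X z>
([dissipationE]). When U_X is positive definite, maximising over z (completing
the square, [posdef_completion]) turns the reachability inequality for P into
the inequality D_X(x, y, z) <= 0 for all x, y, z, where X is the inverse of P
([reachability_dissipation]). This removes the inverse of U_X, which is what
makes the inequality awkward to truncate: both S_X and U_X change under
truncation, while D_X is, up to the fixed z^T U z, a drift term plus squared
norms. Likewise LV_X is the value of D_X at z = 0.

Let T and J satisfy T J = 1, and let X1 be a weight with J^T X = X1 T, which
says that J T is an X-orthogonal projection and X1 the weight induced by X on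
its range. For a system with coefficients f_r = T o f o J and so on, the drift
term of D is unchanged, and Pythagoras for the projection J T gives
||X1^(1/2) T A K^(1/2)|| <= ||X^(1/2) A K^(1/2)|| for every A
([energy_projection]). Hence D of the projected system is at most D of the
original one ([dissipation_projection]). For the same reason z^T U_X z can only
increase, so U_X1 stays positive definite ([Umx_form_projection]). The bound in
the observability inequality is unchanged, since h_r = h o J.

Balanced truncation is such a projection, with T the first r rows of the
balancing matrix. The relation J^T X = X1 T holds for both weights in play, Q
and the inverse of P, because both are diagonal in the balanced coordinates.

Finally, the norms above involve X^(1/2) and K^(1/2), so square roots of
positive semidefinite matrices have to exist: see [sqrtmx_exists]. *)

Set Implicit Arguments.
Unset Strict Implicit.
Unset Printing Implicit Defensive.

Import Order.TTheory GRing.Theory Num.Theory.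
Local Open Scope ring_scope.

(** * Polynomials in a matrix *)

Lemma poly_interpolation (F : fieldType) (s : seq F) (g : F -> F) :
  exists p : {poly F}, {in s, forall x, p.[x] = g x}.
Proof.
elim: s => [|a s [p pg]]; first by exists 0.
have [as_in|as_nin] := boolP (a \in s).
  by exists p => x; rewrite inE => /predU1P[->|]; apply: pg.
pose w : {poly F} := \prod_(b <- s) ('X - b%:P).
have wa : w.[a] != 0 by rewrite -rootE root_prod_XsubC.
exists (p + ((g a - p.[a]) / w.[a]) *: w) => x.
rewrite inE hornerD hornerZ => /predU1P[->|xs].
  by rewrite divfK // addrC subrK.
have /eqP -> : w.[x] == 0 by rewrite -rootE root_prod_XsubC.
by rewrite mulr0 addr0 pg.
Qed.

Lemma trmx_horner (F : comNzRingType) n (A : 'M[F]_n.+1) (p : {poly F}) :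
  (horner_mx A p)^T = horner_mx A^T p.
Proof.
elim/poly_ind: p => [|p c IHp]; first by rewrite !rmorph0 linear0.
rewrite !(rmorphD, rmorphM) /= !horner_mx_X !horner_mx_C linearD /=.
rewrite tr_scalar_mx trmx_mul IHp; congr (_ + _).
by apply: comm_mx_horner.
Qed.

(** * Semidefinite matrices and their square roots *)

Section PositiveMatrices.
Variable R : realType.

Lemma innerE n (u v : 'cV[R]_n) : inner u v = \tr (u^T *m v).
Proof. by rewrite trace_mx11 mxE; apply: eq_bigr => i _; rewrite mxE. Qed.

Lemma frobeniusE m n (A : 'M[R]_(m, n)) : frobenius A ^+ 2 = \tr (A^T *m A).
Proof.
rewrite sqr_sqrtr; last by do 2!apply: sumr_ge0 => ? _; rewrite sqr_ge0.
rewrite exchange_big; apply: eq_bigr => j _; rewrite mxE.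
by apply: eq_bigr => i _; rewrite mxE expr2.
Qed.

Lemma inner_ge0 n (v : 'cV[R]_n) : 0 <= inner v v.
Proof. by apply: sumr_ge0 => i _; rewrite -expr2 sqr_ge0. Qed.

Lemma inner_gt0 n (v : 'cV[R]_n) : v != 0 -> 0 < inner v v.
Proof.
move=> v0; rewrite lt_def inner_ge0 andbT; apply: contraNneq v0 => /eqP.
rewrite psumr_eq0 => [/allP vi0|i _]; last by rewrite -expr2 sqr_ge0.
apply/eqP/colP => i; rewrite mxE; apply/eqP.
by have := vi0 i (mem_index_enum i); rewrite mulf_eq0 orbb.
Qed.

Lemma posdef_possemidef n (X : 'M[R]_n) : posdef X -> possemidef X.
Proof.
move=> [Xs Xp]; split=> // v; have [->|/Xp/ltW //] := eqVneq v 0.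
by rewrite mulmx0 innerE mulmx0 linear0.
Qed.

Lemma possemidef_eigenvalue_ge0 n (A : 'M[R]_n) (a : R) :
  possemidef A -> eigenvalue A a -> 0 <= a.
Proof.
move=> [As Ap] /eigenvalueP[v vA v0]; have v0' : v^T != 0.
  by apply: contraNneq v0 => /(congr1 trmx); rewrite trmxK linear0 => ->.
rewrite -(pmulr_lge0 _ (inner_gt0 v0')).
have := Ap v^T; rewrite -[A in X in 0 <= X]As -trmx_mul vA linearZ /=.
by rewrite !innerE -scalemxAr linearZ.
Qed.

(** A is diagonalizable over the complex numbers, with real eigenvalues, so a
polynomial vanishing on its spectrum annihilates it. Phrased with real
polynomials, this spectral theorem mentions no complex matrix, which keeps the
functions of A used below real. *)
Lemma possemidef_split_annihilator n (A : 'M[R]_n.+1) : possemidef A ->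
  exists2 s : seq R, {in s, forall a, 0 <= a} &
    forall p : {poly R}, {in s, forall a, p.[a] = 0} -> horner_mx A p = 0.
Proof.
move=> Ap; have [As _] := Ap.
pose AC := map_mx (real_complex R) A.
have AC_herm : AC \is hermsymmx.
  apply: realsym_hermsym.
    apply/is_hermitianmxP; rewrite expr0 scale1r map_mx_id //.
    by rewrite /AC map_trmx As.
  by apply/mxOverP => i j; rewrite mxE; apply/complex_realP; exists (A i j).
have /orthomx_spectralP ACE := hermitian_normalmx AC_herm.
have dR := hermitian_spectral_diag_real AC_herm.
set V := spectralmx AC in ACE; set d := spectral_diag AC in ACE dR.
have V_unit : V \in unitmx by exact: spectral_unit.
pose e i := complex.Re (d 0 i).
have de i : d 0 i = real_complex R (e i).
  by have /mxOverP/(_ 0 i)/complex_realP[a da] := dR; rewrite /e da.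
exists (codom e) => [_ /codomP[i ->]|p p0].
  (* The characteristic polynomial transfers eigenvalues from C back to R. *)
  apply: (possemidef_eigenvalue_ge0 Ap); rewrite eigenvalue_root_char.
  rewrite -(fmorph_root (real_complex R)) map_char_poly -eigenvalue_root_char.
  apply/eigenvalueP; exists (row i V); last first.
    apply: contraTneq V_unit => Vi0; rewrite -row_free_unit.
    apply/negP => /row_freeP[W VW].
    have := congr1 (row i) VW; rewrite row_mul Vi0 mul0mx => /rowP/(_ i).
    by rewrite !mxE eqxx => /esym/eqP; rewrite oner_eq0.
  rewrite -row_mul -/AC {1}ACE -!mulmxA mulKVmx //.
  by rewrite mul_diag_mx; apply/rowP => j; rewrite !mxE de.
apply: (map_mx_inj (f := real_complex R)).
rewrite map_horner_mx -/AC ACE horner_mx_uconjC // horner_mx_diag.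
suff -> : map_mx (horner (map_poly (real_complex R) p)) d = 0.
  by rewrite linear0 mulmx0 mul0mx map_mx0.
apply/rowP => i; rewrite !mxE de horner_map p0 ?rmorph0 //; exact: codom_f.
Qed.

(** If g takes the value a^(1/4) at each eigenvalue a of X, then g(X)^4 = X.
The fourth root is used because g(X)^2 is then visibly semidefinite, being the
square of a symmetric matrix. *)
Lemma sqrtmx_exists n (X : 'M[R]_n) : possemidef X ->
  exists2 Y, possemidef Y & Y *m Y = X.
Proof.
case: n X => [|n] X Xp.
  by exists X => //; apply/matrixP => -[].
have [s s_ge0 s_ann] := possemidef_split_annihilator Xp.
have [g gE] := poly_interpolation s (fun a => Num.sqrt (Num.sqrt a)).
pose Z := horner_mx X g.
have Zs : Z^T = Z by rewrite trmx_horner (proj1 Xp).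
exists (Z *m Z); first split.
- by rewrite trmx_mul Zs.
- move=> v; rewrite -{1}Zs innerE !mulmxA -trmx_mul -mulmxA -innerE.
  exact: inner_ge0.
- have -> : Z *m Z *m (Z *m Z) = horner_mx X (g * g * (g * g)).
    by rewrite !rmorphM.
  apply/eqP; rewrite -subr_eq0 -[W in _ - W]horner_mx_X -rmorphB.
  apply/eqP/s_ann => a sa; rewrite !(hornerE, gE a sa) /=.
  set b := Num.sqrt (Num.sqrt a).
  have bb : b * b = Num.sqrt a by rewrite -expr2 sqr_sqrtr ?sqrtr_ge0.
  by rewrite -mulrA !bb -expr2 sqr_sqrtr ?s_ge0 // subrr.
Qed.

Lemma sqrtmxP n (X : 'M[R]_n) : possemidef X ->
  (sqrtmx X)^T = sqrtmx X /\ sqrtmx X *m sqrtmx X = X.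
Proof.
move=> /sqrtmx_exists[Y Yp YY].
by have [[]] : possemidef (sqrtmx X) /\ sqrtmx X *m sqrtmx X = X
  by rewrite /sqrtmx; case: xgetP => [Z -> []//|/(_ Y)[]].
Qed.

Lemma frobenius_sqrtmx n q (X : 'M[R]_n) (K : 'M[R]_q) (A : 'M[R]_(n, q)) :
  possemidef X -> possemidef K ->
  frobenius (sqrtmx X *m A *m sqrtmx K) ^+ 2 = \tr (A^T *m X *m A *m K).
Proof.
move=> /sqrtmxP[sXs sXX] /sqrtmxP[sKs sKK].
rewrite frobeniusE !trmx_mul sXs sKs -[in RHS]sXX -[in RHS]sKK.
by rewrite [in RHS]mulmxA [RHS]mxtrace_mulC !mulmxA.
Qed.

Lemma inner_sym n (u v : 'cV[R]_n) : inner u v = inner v u.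
Proof. by apply: eq_bigr => i _; rewrite mulrC. Qed.

Lemma innerDl n (u v w : 'cV[R]_n) : inner (u + v) w = inner u w + inner v w.
Proof. by rewrite !innerE linearD mulmxDl linearD. Qed.

Lemma innerDr n (u v w : 'cV[R]_n) : inner u (v + w) = inner u v + inner u w.
Proof. by rewrite !innerE mulmxDr linearD. Qed.

Lemma innerZr n a (u v : 'cV[R]_n) : inner u (a *: v) = a * inner u v.
Proof. by rewrite !innerE -scalemxAr linearZ. Qed.

Lemma inner_sumr n (I : finType) (u : 'cV[R]_n) (F : I -> 'cV[R]_n) :
  inner u (\sum_i F i) = \sum_i inner u (F i).
Proof.
rewrite innerE mulmx_sumr linear_sum.
by apply: eq_bigr => i _; rewrite innerE.
Qed.

Lemma inner0l n (u : 'cV[R]_n) : inner 0 u = 0.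
Proof. by rewrite innerE trmx0 mul0mx linear0. Qed.

Lemma inner_mull m n (A : 'M[R]_(m, n)) u v :
  inner (A *m u) v = inner u (A^T *m v).
Proof. by rewrite !innerE trmx_mul mulmxA. Qed.

Lemma posdef_unitmx n (X : 'M[R]_n) : posdef X -> X \in unitmx.
Proof.
move=> [Xs Xp]; rewrite -unitmx_tr Xs -row_free_unit -kermx_eq0.
apply/eqP/row_matrixP => i; rewrite row0; apply/eqP/contraT => ker_neq0.
have := Xp (row i (kermx X))^T; rewrite trmx_eq0 => /(_ ker_neq0).
have -> : X *m (row i (kermx X))^T = 0.
  by rewrite -{1}Xs -trmx_mul -row_mul mulmx_ker row0 trmx0.
by rewrite innerE mulmx0 linear0 ltxx.
Qed.

Lemma posdef_inv n (X : 'M[R]_n) : posdef X -> posdef (invmx X).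
Proof.
move=> Xpd; have Xu := posdef_unitmx Xpd; have [Xs Xp] := Xpd.
split=> [|v v0]; first by rewrite trmx_inv Xs.
rewrite -{1}(mulKVmx Xu v) inner_sym; apply: Xp.
by apply: contraNneq v0 => Xv; rewrite -(mulKVmx Xu v) Xv mulmx0.
Qed.

Lemma posdef_diag n (d : 'rV[R]_n) :
  (forall i, 0 < d 0 i) -> posdef (diag_mx d).
Proof.
move=> d_gt0; split=> [|v v0]; first by rewrite tr_diag_mx.
have vE : inner v (diag_mx d *m v) = \sum_i d 0 i * v i 0 ^+ 2.
  by apply: eq_bigr => i _; rewrite mul_diag_mx mxE mulrCA expr2.
have term_ge0 i : 0 <= d 0 i * v i 0 ^+ 2.
  by rewrite mulr_ge0 ?sqr_ge0 // ltW.
rewrite vE lt_def sumr_ge0 // andbT psumr_eq0 //.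
apply: contraNN v0 => /allP v0; apply/eqP/colP => i; rewrite mxE; apply/eqP.
have := v0 i (mem_index_enum i).
by rewrite mulf_eq0 (gt_eqF (d_gt0 i)) sqrf_eq0.
Qed.

(** The concave quadratic in z attains its maximum, a + s^T V^(-1) s, at
w = V^(-1) s; its deficit at z is the V-norm squared of z - w. *)
Lemma posdef_completion n (V : 'M[R]_n) (s : 'cV[R]_n) (a : R) : posdef V ->
  (forall z, a + 2 * inner z s - inner z (V *m z) <= 0) <->
  a <= - inner s (invmx V *m s).
Proof.
move=> Vpd; have Vu := posdef_unitmx Vpd; have [Vs Vp] := Vpd.
set w := invmx V *m s; have sE : s = V *m w by rewrite mulKVmx.
split=> [/(_ w)|a_le z].
  rewrite -sE [inner w s]inner_sym; lra.
have cross : inner w (V *m z) = inner z s.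
  by rewrite -{1}Vs -inner_mull inner_sym -sE.
have := (posdef_possemidef Vpd).2 (z + -1 *: w).
rewrite mulmxDr -scalemxAr -sE innerDr innerZr 2!innerDl.
rewrite ![inner (_ *: w) _]inner_sym !innerZr ![inner _ w]inner_sym cross.
by rewrite (inner_sym s w) in a_le *; lra.
Qed.

(** * Weighted energy of a matrix *)

(** This is the squared Frobenius norm of X^(1/2) A K^(1/2), written without
square roots so that it is polynomial in the entries of its arguments. *)
Definition energy n q (X : 'M[R]_n) (K : 'M[R]_q) (A : 'M[R]_(n, q)) : R :=
  \tr (A^T *m X *m A *m K).

Lemma energy_ge0 n q (X : 'M[R]_n) (K : 'M[R]_q) (A : 'M[R]_(n, q)) :
  possemidef X -> possemidef K -> 0 <= energy X K A.
Proof. by move=> Xp Kp; rewrite /energy -frobenius_sqrtmx // sqr_ge0. Qed.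

Lemma possemidef1 n : possemidef (1%:M : 'M[R]_n).
Proof. by split=> [|v]; rewrite ?trmx1 // mul1mx inner_ge0. Qed.

Lemma frobenius_sqrtmx1 n m (X : 'M[R]_n) (A : 'M[R]_(n, m)) :
  possemidef X -> frobenius (sqrtmx X *m A) ^+ 2 = energy X 1%:M A.
Proof.
move=> /sqrtmxP[sXs sXX].
by rewrite /energy frobeniusE mulmx1 trmx_mul sXs -[in RHS]sXX !mulmxA.
Qed.

Lemma trace_cross n q (X : 'M[R]_n) (K : 'M[R]_q) (A C : 'M[R]_(n, q)) :
  K^T = K ->
  \tr (A^T *m X *m C *m K) =
  \sum_i \sum_j K i j * inner (col i A) (X *m col j C).
Proof.
move=> Ks; apply: eq_bigr => i _; rewrite mxE; apply: eq_bigr => j _.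
have -> : K j i = K i j by rewrite -[in LHS]Ks mxE.
rewrite mulrC -mulmxA mxE; congr (_ * _).
apply: eq_bigr => k _; rewrite !mxE; congr (_ * _).
by apply: eq_bigr => l _; rewrite mxE.
Qed.

(** Polarization: the two cross terms are transposes of each other. *)
Lemma energyD n q (X : 'M[R]_n) (K : 'M[R]_q) (A C : 'M[R]_(n, q)) :
  X^T = X -> K^T = K ->
  energy X K (A + C) =
  energy X K A + 2 * \tr (C^T *m X *m A *m K) + energy X K C.
Proof.
move=> Xs Ks.
have sym : \tr (A^T *m X *m C *m K) = \tr (C^T *m X *m A *m K).
  by rewrite -mxtrace_tr !trmx_mul trmxK Xs Ks mxtrace_mulC !mulmxA.
by rewrite /energy [(A + C)^T]linearD !(mulmxDl, mulmxDr) !mxtraceD sym; ring.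
Qed.

(** The hypothesis on J^T X makes the X-cross terms between the range of J and
the kernel of T vanish, so Pythagoras splits the energy of A into that of its
projection J T A, which X1 measures on T A, and that of A - J T A. *)
Lemma energy_projection n r q (X : 'M[R]_n) (X1 : 'M[R]_r) (K : 'M[R]_q)
    (T : 'M[R]_(r, n)) (J : 'M[R]_(n, r)) (A : 'M[R]_(n, q)) :
  possemidef X -> possemidef K -> X1^T = X1 -> T *m J = 1%:M ->
  J^T *m X = X1 *m T ->
  energy X1 K (T *m A) <= energy X K A.
Proof.
move=> Xp Kp X1s TJ JX.
have XJ : X *m J = T^T *m X1
  by have := congr1 trmx JX; rewrite !trmx_mul trmxK (proj1 Xp) X1s.
have -> : energy X K A = energy X1 K (T *m A) + energy X K (A - J *m (T *m A)).
  rewrite /energy -linearD /=; congr (\tr _).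
  rewrite -mulmxDl; congr (_ *m _).
  rewrite [(A - _)^T]linearB /= !trmx_mul !(mulmxBl, mulmxBr) -!mulmxA.
  rewrite ![J^T *m (X *m _)]mulmxA JX ![X *m (J *m _)]mulmxA XJ -!mulmxA.
  by rewrite ![T *m (J *m _)]mulmxA TJ mul1mx subrr subr0 addrC subrK.
by rewrite lerDl energy_ge0.
Qed.

End PositiveMatrices.

(** * The dissipation functional *)

Section Dissipation.
Variables (R : realType) (n m q p : nat).
Variables (K : 'M[R]_q) (U : 'M[R]_m) (sys : stoch_system R n m q p).
Implicit Types (X : 'M[R]_n) (x y : 'cV[R]_n) (z : 'cV[R]_m).

(** The first and third terms are the generator applied to the X-weighted
squared distance of two copies of the system stripped of its bilinear part G,
with the input z entering only the first copy. *)
Definition dissipation X delta x y z : R :=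
  2 * inner (x - y) (X *m (sys_f sys x - sys_f sys y + sys_B sys *m z))
  + delta ^+ 2 * energy X 1%:M (sys_G sys x - sys_G sys y)
  + energy X K (sys_Gamma sys x - sys_Gamma sys y + sys_Mfun sys z)
  - inner z (U *m z).

Lemma trace_Mfun X (A : 'M[R]_(n, q)) z : K^T = K ->
  \tr ((sys_Mfun sys z)^T *m X *m A *m K) =
  inner z (\sum_i \sum_j K i j *: ((sys_M sys i)^T *m X *m col j A)).
Proof.
move=> Ks; rewrite trace_cross // inner_sumr; apply: eq_bigr => i _.
rewrite inner_sumr; apply: eq_bigr => j _; rewrite innerZr; congr (_ * _).
rewrite -mulmxA -inner_mull; congr inner.
by apply/colP => k; rewrite !mxE.
Qed.

Lemma Umx_form X z : K^T = K ->
  inner z (Umx K sys U X *m z) = inner z (U *m z) - energy X K (sys_Mfun sys z).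
Proof.
move=> Ks; rewrite /energy trace_Mfun // mulmxBl.
rewrite innerDr -scaleN1r innerZr mulN1r.
congr (_ - inner _ _); rewrite mulmx_suml; apply: eq_bigr => i _.
rewrite mulmx_suml; apply: eq_bigr => j _; rewrite -scalemxAl -!mulmxA.
by congr (_ *: (_ *m (_ *m _))); apply/colP => k; rewrite !mxE.
Qed.

Lemma Umx_sym X : K^T = K -> X^T = X -> U^T = U ->
  (Umx K sys U X)^T = Umx K sys U X.
Proof.
move=> Ks Xs Us; rewrite /Umx linearB /= Us; congr (_ - _).
rewrite [RHS]exchange_big linear_sum; apply: eq_bigr => i _.
rewrite linear_sum; apply: eq_bigr => j _.
rewrite linearZ /= !trmx_mul trmxK Xs mulmxA; congr (_ *: _).
by rewrite -{1}Ks mxE.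
Qed.

(** The noise energy of Gamma x - Gamma y + M(z) contributes its z-linear part
to [Svec] and its z-quadratic part to [Umx]. *)
Lemma dissipationE X delta x y z : possemidef X -> possemidef K ->
  dissipation X delta x y z =
  LV K sys X x y delta + 2 * inner z (Svec K sys X x y)
  - inner z (Umx K sys U X *m z).
Proof.
move=> Xp Kp; have [Xs _] := Xp; have [Ks _] := Kp.
rewrite Umx_form // /LV frobenius_sqrtmx1 // frobenius_sqrtmx //.
rewrite /dissipation (energyD _ (sys_Mfun sys z) Xs Ks) trace_Mfun //.
rewrite /Svec innerDr mulmxDr innerDr.
have -> : inner (x - y) (X *m (sys_B sys *m z)) =
          inner z ((sys_B sys)^T *m X *m (x - y)).
  by rewrite -mulmxA -inner_mull -[in LHS]Xs -inner_mull inner_sym.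
have -> : \sum_i \sum_j K i j *: ((sys_M sys i)^T *m X *m
            (sys_gamma sys j x - sys_gamma sys j y)) =
          \sum_i \sum_j K i j *: ((sys_M sys i)^T *m X *m
            col j (sys_Gamma sys x - sys_Gamma sys y)).
  by do 2!apply: eq_bigr => ? _; rewrite /sys_gamma -linearB.
by rewrite -/(energy X K (sys_Gamma sys x - sys_Gamma sys y)); ring.
Qed.

(** Quantifying over the input z eliminates the inverse of [Umx]; in this form
the condition is monotone under projection. *)
Lemma reachability_dissipation P : possemidef K ->
  reachability_gramian K sys U P <->
  [/\ posdef P, posdef (Umx K sys U (invmx P)) &
      exists2 delta, 0 < delta &
        forall x y z, dissipation (invmx P) delta x y z <= 0].
Proof.
move=> Kp; split=> -[Pp Up [delta delta_gt0 dP]]; split=> //;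
  exists delta => // x y; have Xp := posdef_possemidef (posdef_inv Pp).
- by move=> z; rewrite dissipationE //; apply: (posdef_completion _ _ Up).2.
- by apply: (posdef_completion _ _ Up).1 => z; rewrite -dissipationE.
Qed.

Lemma dissipation0 X delta x y : possemidef X -> possemidef K ->
  LV K sys X x y delta = dissipation X delta x y 0.
Proof. by move=> *; rewrite dissipationE // !inner0l mulr0 subr0 addr0. Qed.

End Dissipation.

(** * Monotonicity under oblique projection *)

Section ObliqueProjection.
Variables (R : realType) (n r m q p : nat).
Variables (sys : stoch_system R n m q p) (sysr : stoch_system R r m q p).
Variables (T : 'M[R]_(r, n)) (J : 'M[R]_(n, r)).

(** T restricts to coordinates on the range of J, on which J T is the identity,
and sysr is the resulting Petrov-Galerkin reduction of sys. *)
Record oblique_projection : Prop := ObliqueProjection {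
  proj_TJ : T *m J = 1%:M;
  proj_f : forall x, sys_f sysr x = T *m sys_f sys (J *m x);
  proj_B : sys_B sysr = T *m sys_B sys;
  proj_G : forall x, sys_G sysr x = T *m sys_G sys (J *m x);
  proj_Gamma : forall x, sys_Gamma sysr x = T *m sys_Gamma sys (J *m x);
  proj_M : forall i, sys_M sysr i = T *m sys_M sys i;
  proj_h : forall x, sys_h sysr x = sys_h sys (J *m x)
}.

Hypothesis proj : oblique_projection.
Variables (K : 'M[R]_q) (U : 'M[R]_m).
Hypothesis Kp : possemidef K.

Lemma proj_Mfun z : sys_Mfun sysr z = T *m sys_Mfun sys z.
Proof.
apply/matrixP => i j; rewrite mxE proj_M // -mulmxA !mxE.
by apply: eq_bigr => k _; rewrite [in RHS]mxE.
Qed.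

Section Weights.
Variables (X : 'M[R]_n) (X1 : 'M[R]_r).
Hypotheses (Xp : possemidef X) (X1s : X1^T = X1) (JX : J^T *m X = X1 *m T).

(** By the relation between X and X1, the drift terms agree exactly, whereas
the two energies can only decrease. *)
Lemma dissipation_projection delta x y z :
  dissipation K U sysr X1 delta x y z <=
  dissipation K U sys X delta (J *m x) (J *m y) z.
Proof.
have [TJ rf rB rG rGamma _ _] := proj.
rewrite /dissipation !rf !rG !rGamma rB proj_Mfun -mulmxA -!mulmxBr -!mulmxDr.
rewrite inner_mull !mulmxA JX lerD2r.
rewrite lerD ?(energy_projection _ Xp Kp X1s TJ JX) // lerD // ler_wpM2l //.
  by rewrite sqr_ge0.
exact: energy_projection (possemidef1 _ _) X1s TJ JX.
Qed.

(** The noise energy of the input, which [Umx] subtracts from U, decreases. *)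
Lemma Umx_form_projection z :
  inner z (Umx K sys U X *m z) <= inner z (Umx K sysr U X1 *m z).
Proof.
rewrite !Umx_form ?(proj1 Kp) // lerD2l lerN2 proj_Mfun.
exact: energy_projection Xp Kp X1s (proj_TJ proj) JX.
Qed.

End Weights.

Lemma reachability_projection (P : 'M[R]_n) (P1 : 'M[R]_r) :
  U^T = U -> posdef P1 -> J^T *m invmx P = invmx P1 *m T ->
  reachability_gramian K sys U P -> reachability_gramian K sysr U P1.
Proof.
move=> Us P1p JP /(reachability_dissipation _ _ _ Kp)[Pp [_ Up] [delta d0 dP]].
have Xp := posdef_possemidef (posdef_inv Pp).
have [X1s _] := posdef_inv P1p.
apply/reachability_dissipation => //; split=> //.
  split=> [|z z0]; first by rewrite Umx_sym // (proj1 Kp).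
  exact: lt_le_trans (Up z z0) (Umx_form_projection Xp X1s JP z).
exists delta => // x y z.
exact: le_trans (dissipation_projection Xp X1s JP delta x y z) (dP _ _ _).
Qed.

Lemma observability_projection (Q : 'M[R]_n) (Q1 : 'M[R]_r) :
  possemidef Q1 -> J^T *m Q = Q1 *m T ->
  observability_gramian K sys Q -> observability_gramian K sysr Q1.
Proof.
move=> Q1p JQ [Qp [delta d0 dQ]]; split=> //; exists delta => // x y.
rewrite !(proj_h proj); apply: le_trans (dQ (J *m x) (J *m y)).
rewrite (dissipation0 U sysr) // (dissipation0 U sys) //.
exact: dissipation_projection Qp (proj1 Q1p) JQ delta x y 0.
Qed.

End ObliqueProjection.

(** * Balanced truncation *)

Section BalancedTruncation.
Variables (R : realType) (r n : nat) (le_rn : (r <= n)%N).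

Lemma first_rowsE k (A : 'M[R]_(n, k)) :
  first_rows le_rn A = first_rows le_rn 1%:M *m A.
Proof. by rewrite /first_rows mul_rowsub_mx mul1mx. Qed.

Lemma zero_padE (x : 'cV[R]_r) :
  zero_pad n x = (first_rows le_rn 1%:M)^T *m x.
Proof.
apply/colP => i; rewrite !mxE.
have [lt_ir|ge_ir] := ltnP i r.
  rewrite insubT /= (bigD1 (Ordinal lt_ir)) //= big1 ?addr0 => [|j ji].
    have iE : widen_ord le_rn (Ordinal lt_ir) = i by exact: val_inj.
    by rewrite !mxE iE eqxx mul1r.
  rewrite !mxE; case: eqP => [/(congr1 val)/= jiE|]; last by rewrite mul0r.
  by case/eqP: ji; apply: val_inj.
rewrite insubN -?leqNgt //= big1 // => j _; rewrite !mxE.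
case: eqP => [/(congr1 val)/= jiE|]; last by rewrite mul0r.
by have := ltn_ord j; rewrite jiE ltnNge ge_ir.
Qed.

Lemma first_rows_orthonormal :
  first_rows le_rn 1%:M *m (first_rows le_rn 1%:M)^T = 1%:M :> 'M[R]_r.
Proof.
rewrite -first_rowsE; apply/matrixP => i j; rewrite !mxE.
by rewrite eq_sym -!val_eqE.
Qed.

(** Truncation intertwines a diagonal matrix with its leading block: in balanced
coordinates this is the decoupling that the projection results require. *)
Lemma first_rows_diag (d : 'rV[R]_n) :
  first_rows le_rn 1%:M *m diag_mx d =
  diag_mx (\row_(i < r) d 0 (widen_ord le_rn i)) *m first_rows le_rn 1%:M.
Proof.
rewrite mul_mx_diag mul_diag_mx; apply/matrixP => i j; rewrite !mxE.
by case: eqP => [->|_]; rewrite ?mulr0 ?mul0r // mulrC.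
Qed.

Lemma reduced_system_projection m q p (S : 'M[R]_n)
    (sys : stoch_system R n m q p) : S \in unitmx ->
  oblique_projection sys (reduced_system le_rn S sys)
    (first_rows le_rn 1%:M *m S) (invmx S *m (first_rows le_rn 1%:M)^T).
Proof.
move=> Su; split=> *; rewrite /= ?zero_padE ?mulmxA ?mulmxK //;
  try by rewrite first_rowsE mulmxA.
exact: first_rows_orthonormal.
Qed.

End BalancedTruncation.

Theorem proposition5p1 (R : realType) (n m q p r : nat)
    (K : 'M[R]_q) (hK : possemidef K)
    (sys : stoch_system R n m q p)
    (U : 'M[R]_m) (hU : posdef U)
    (P Q : 'M[R]_n)
    (hP : reachability_gramian K sys U P)
    (hQ : observability_gramian K sys Q)
    (S : 'M[R]_n) (hS : S \in unitmx)
    (sigma : 'rV[R]_n) (hsigma : forall i : 'I_n, 0 < sigma 0 i)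
    (hSP : S *m P *m S^T = diag_mx sigma)
    (hSQ : (invmx S)^T *m Q *m invmx S = diag_mx sigma)
    (hr : (1 <= r)%N) (hrn : (r < n)%N) :
  let Sigma1 : 'M[R]_r :=
    diag_mx (\row_(i < r) sigma 0 (widen_ord (ltnW hrn) i)) in
  let sys_r := reduced_system (ltnW hrn) S sys in
  reachability_gramian K sys_r U Sigma1 /\
  observability_gramian K sys_r Sigma1.
Proof.
move=> Sigma1 sys_r.
have proj := reduced_system_projection (ltnW hrn) sys hS.
have Sigma1p : posdef Sigma1 by apply: posdef_diag => i; rewrite mxE.
have comm := first_rows_diag (ltnW hrn) sigma; rewrite -/Sigma1 in comm.
have [Ppd _ _] := hP; have Pu := posdef_unitmx Ppd.
split.
  apply: (reachability_projection proj hK (proj1 hU) Sigma1p _ hP).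
  (* Cancelling P and S^T on the right reduces J^T P^-1 = Sigma1^-1 T to the
     intertwining relation for Sigma. *)
  have Stu : S^T \in unitmx by rewrite unitmx_tr.
  apply: (can_inj (mulmxK Pu)); apply: (can_inj (mulmxK Stu)).
  rewrite mulmxKV // trmx_mul trmxK trmx_inv mulmxKV //.
  rewrite -!mulmxA [S *m _]mulmxA hSP comm mulmxA mulVmx ?mul1mx //.
  exact: posdef_unitmx.
apply: (observability_projection proj U hK (posdef_possemidef Sigma1p) _ hQ).
have Su' : invmx S \in unitmx by rewrite unitmx_inv.
apply: (can_inj (mulmxK Su')).
rewrite trmx_mul trmxK -mulmxA -mulmxA [_^T *m _]mulmxA hSQ comm.
by rewrite !mulmxA mulmxK.
Qed.
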